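(* Let $a,b\in[0,1]$ with $a<b$. The set $C_a^b([0,1])$ of all continuous maps $\phi:[0,1]\to[0,1]$ such that $$\underline{\mathrm{mdim}}_{\mathrm{M}}([0,1],|\cdot|,\phi)=a\quad\text{and}\quad\overline{\mathrm{mdim}}_{\mathrm{M}}([0,1],|\cdot|,\phi)=b$$ is dense in $C^0([0,1])$.
   Context: $C^0([0,1])$ is the space of continuous maps $\phi:[0,1]\to[0,1]$, endowed with the metric $\hat d(\phi,\psi)=\max_{x\in[0,1]}|\phi(x)-\psi(x)|$. Metric mean dimension: let $(X,d)$ be a compact metric space and $\phi:X\to X$ continuous. For $n\in\mathbb{N}$, $n\ge 1$, put $d_n(x,y)=\max\{d(x,y),d(\phi(x),\phi(y)),\dots,d(\phi^{n-1}(x),\phi^{n-1}(y))\}$. For $\varepsilon>0$, a set $A\subset X$ is $(n,\phi,\varepsilon)$-separated if $d_n(x,y)>\varepsilon$ for any two distinct $x,y\in A$; $\mathrm{sep}(n,\phi,\varepsilon)$ is the maximal cardinality of an $(n,\phi,\varepsilon)$-separated subset of $X$. Put $\mathrm{sep}(\phi,\varepsilon)=\limsup_{n\to\infty}\frac1n\log\mathrm{sep}(n,\phi,\varepsilon)$. The lower and upper metric mean dimensions are $$\underline{\mathrm{mdim}}_{\mathrm{M}}(X,d,\phi)=\liminf_{\varepsilon\to0}\frac{\mathrm{sep}(\phi,\varepsilon)}{|\log\varepsilon|},\qquad \overline{\mathrm{mdim}}_{\mathrm{M}}(X,d,\phi)=\limsup_{\varepsilon\to0}\frac{\mathrm{sep}(\phi,\varepsilon)}{|\log\varepsilon|}.$$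 On $[0,1]$, $|\cdot|$ denotes the metric $d(x,y)=|x-y|$. *)

(* Defs.v *)
From HB Require Import structures.
From mathcomp Require Import all_boot all_order all_algebra finmap.
From mathcomp Require Import all_classical all_reals all_analysis.

Set Implicit Arguments.
Unset Strict Implicit.
Unset Printing Implicit Defensive.

Import Order.TTheory GRing.Theory Num.Theory.
Import numFieldNormedType.Exports.

Local Open Scope classical_set_scope.
Local Open Scope ring_scope.

Section metric_mean_dimension.
Context {R : realType} {X : metricType R}.
Implicit Types (phi : X -> X) (n : nat) (e : R).

(* [dist_n phi 0] is constantly 0; only the values for n >= 1 matter. *)
Definition dist_n phi n (x y : X) : R :=
  \big[Num.max/0]_(i < n) mdist (iter i phi x) (iter i phi y).

Definition n_separated n phi e (A : set X) : Prop :=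
  forall x y, A x -> A y -> x <> y -> e < dist_n phi n x y.

(* The largest cardinality is taken in \bar R, over the finite separated sets:
   it is +oo exactly when these have unbounded cardinality, which does not
   happen when X is compact and phi is continuous (n >= 1, e > 0). *)
Definition sep_n n phi e : \bar R :=
  ereal_sup [set (#|` A|%fset%:R)%:E |
              A in [set A : {fset X} | n_separated n phi e [set` A]]].

Definition sep phi e : \bar R :=
  limn_esup (fun n => (n%:R^-1)%:E * lne (sep_n n phi e))%E.

Definition lower_mdim phi : \bar R :=
  limf_einf (fun e : R => sep phi e * (`|ln e|^-1)%:E)%E 0^'+.

Definition upper_mdim phi : \bar R :=
  limf_esup (fun e : R => sep phi e * (`|ln e|^-1)%:E)%E 0^'+.

End metric_mean_dimension.

Definition unitI (R : realType) : Type := set_type (`[0, 1]%classic : set R).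

Section unitI_metric.
Context {R : realType}.

HB.instance Definition _ := PseudoMetric.on (unitI R).

Definition unitI_dist (x y : unitI R) : R := `|set_val x - set_val y|.

Let dist_ge0 x y : 0 <= unitI_dist x y.
Proof. exact: normr_ge0. Qed.

Let dist_pos x y : unitI_dist x y = 0 -> x = y.
Proof. by move=> /normr0_eq0/eqP; rewrite subr_eq0 => /eqP /val_inj. Qed.

Let dist_ball (x : unitI R) d : ball x d = [set y | unitI_dist x y < d].
Proof. by []. Qed.

HB.instance Definition _ :=
  PseudoMetric_isMetric.Build R (unitI R) dist_ge0 dist_pos dist_ball.

Lemma unitI_distE (x y : unitI R) : mdist x y = `|set_val x - set_val y|.
Proof. by []. Qed.

Lemma unitI_dist_le1 (x y : unitI R) : unitI_dist x y <= 1.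
Proof.
have xI := set_valP x; have yI := set_valP y.
rewrite /= !in_itv /= in xI yI; move/andP: xI => [x0 x1].
move/andP: yI => [y0 y1]; rewrite /unitI_dist ler_norml; apply/andP; split.
  by rewrite lerBrDr (le_trans _ x0)// addrC subr_le0.
by rewrite lerBlDr (le_trans x1)// lerDl.
Qed.

Lemma unitI_compact : compact [set: unitI R].
Proof.
have I0 : (0 : R) \in (`[0, 1]%classic : set R).
  by rewrite inE /= in_itv /= lexx ler01.
pose p : R -> unitI R := insubd (exist _ 0 I0 : unitI R).
have pK (x : unitI R) : p (set_val x) = x by rewrite /p set_valE valKd.
rewrite (_ : [set: unitI R] = p @` `[0, 1]%classic).
  apply: continuous_compact; last exact: segment_compact.
  apply/subspace_sigL_continuousP.
  rewrite (_ : sigL _ _ = (id : unitI R -> unitI R)); first by move=> x; exact.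
  by apply/funext => x; rewrite /sigL /=; exact: pK.
apply/seteqP; split=> // x _.
by exists (set_val x); [exact: set_valP | exact: pK].
Qed.

Lemma set_val_unitI_continuous : continuous (set_val : unitI R -> R).
Proof. exact: initial_continuous. Qed.

End unitI_metric.

Definition C0I (R : realType) : Type := continuousType (unitI R) (unitI R).

Section C0I_metric.
Context {R : realType}.

HB.instance Definition _ := Choice.on (C0I R).

Implicit Types f g h : C0I R.

Definition C0I_fun f : unitI R -> unitI R := (f : continuousType _ _).

Definition C0I_dist f g : R :=
  sup [set mdist (C0I_fun f x) (C0I_fun g x) | x in [set: unitI R]].

Let dist_has_sup f g :
  has_sup [set mdist (C0I_fun f x) (C0I_fun g x) | x in [set: unitI R]].
Proof.
split; last by exists 1 => _ [x _ <-]; exact: unitI_dist_le1.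
have I0 : (0 : R) \in (`[0, 1]%classic : set R).
  by rewrite inE /= in_itv /= lexx ler01.
by eexists; exists (exist _ 0 I0).
Qed.

Let dist_ub f g x : mdist (C0I_fun f x) (C0I_fun g x) <= C0I_dist f g.
Proof. by apply: ub_le_sup; [exact: (dist_has_sup f g).2 | exists x]. Qed.

Let dist_le f g r :
  (forall x, mdist (C0I_fun f x) (C0I_fun g x) <= r) -> C0I_dist f g <= r.
Proof.
move=> fgr; apply: ge_sup; first exact: (dist_has_sup f g).1.
by move=> _ [x _ <-].
Qed.

Let distxx f : C0I_dist f f = 0.
Proof.
apply/eqP; rewrite eq_le; apply/andP; split.
  by apply: dist_le => x; rewrite mdistxx.
have [_ [x _ _]] := (dist_has_sup f f).1.
by rewrite -(mdistxx (C0I_fun f x)).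
Qed.

Let dist_pos f g : C0I_dist f g = 0 -> f = g.
Proof.
move=> fg0; apply/continuousEP => x; apply: mdist_positivity.
by apply/eqP; rewrite eq_le mdist_ge0 andbT -fg0 dist_ub.
Qed.

Let dist_sym f g : C0I_dist f g = C0I_dist g f.
Proof.
by congr sup; apply/seteqP; split=> _ [x _ <-]; exists x => //; exact: metric_sym.
Qed.

Let dist_triangle g f h : C0I_dist f h <= C0I_dist f g + C0I_dist g h.
Proof.
apply: dist_le => x; apply: (le_trans (metric_triangle _ (C0I_fun g x) _)).
by rewrite lerD.
Qed.

HB.instance Definition _ :=
  isMetric.Build R (C0I R) distxx dist_pos dist_sym dist_triangle.

(* The supremum in [C0I_dist] is a maximum. *)
Lemma C0I_dist_max f g : exists2 x : unitI R,
  mdist f g = mdist (C0I_fun f x) (C0I_fun g x) &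
  forall y, mdist (C0I_fun f y) (C0I_fun g y) <= mdist f g.
Proof.
have cv (h : C0I R) : continuous (fun x => set_val (C0I_fun h x) : R).
  move=> x; apply: (@continuous_comp _ _ _ (C0I_fun h) set_val).
    exact: (@cts_fun _ _ (h : continuousType _ _)).
  exact: set_val_unitI_continuous.
have [] := @compact_EVT_max _ R
    (fun x => mdist (C0I_fun f x) (C0I_fun g x)) [set: unitI R] _ unitI_compact.
- by have [_ [x _ _]] := (dist_has_sup f g).1; exists x.
- apply: continuous_subspaceT => x.
  exact: (cvg_norm (cvgB (cv f x) (cv g x))).
move=> x _ xmax; exists x; last exact: dist_ub.
apply/eqP; rewrite eq_le dist_ub andbT.
by apply: dist_le => y; rewrite xmax// inE.
Qed.

End C0I_metric.

Definition C0I_mdim (R : realType) (a b : R) : set (C0I R) :=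
  [set f | lower_mdim (C0I_fun f) = a%:E /\ upper_mdim (C0I_fun f) = b%:E].

(* Main.v *)
Require Import Defs.
From mathcomp Require Import all_boot all_order all_algebra finmap.
From mathcomp Require Import all_classical all_reals all_analysis.
From mathcomp Require Import lra zify ring.

Set Implicit Arguments.
Unset Strict Implicit.
Unset Printing Implicit Defensive.
Import Order.TTheory GRing.Theory Num.Theory.
Import numFieldNormedType.Exports.
Local Open Scope classical_set_scope.
Local Open Scope ring_scope.

(** The growth rate of separated sets at scale [e] is controlled from above by
    the modulus of continuity.  If points at distance less than [e] have images
    at distance at most [e * M], cut the interval into cells of length [e]: the
    next cell visited by an orbit is known up to [2 * M + 1] choices once the
    current one is, and points with the same itinerary are not separated, so
    that the rate is at most [ln (2 * M + 1)] ([sep_n_le_modulus], [sep_le]).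
    Only the modulus enters, so a Lipschitz map has rate [O(1)], and adding a
    function to a Lipschitz map costs what the modulus of that function costs.
    From below, a horseshoe with [m] legs more than [e] apart forces the rate
    to be at least [ln m] ([sep_n_ge_horseshoe], [sep_ge]).

    To approximate a continuous map [f], replace it by a nearby Lipschitz map
    [h] with values in [0, 1 - eta] ([lipschitz_approx]).  It has a fixed point
    [p <= 1 - eta]; collapsing [p, p + delta] to [p] makes [h] constant, equal
    to [p], on that interval, and leaves room to add there a small function
    [tents] from [0, delta] to itself.  This function has, for each [k], on the
    interval [[height k / 2, height k]] with [height k = delta * expR (- k)],
    about [expR (theta k * k)] tents, which rise from 0 to [height k] and hence
    form a horseshoe.  With [t = - ln e], up to additive constants, this horseshoe
    contributes exactly [theta k * k] as soon as [k + theta k * k < t], and the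
    [k]-th family of tents contributes at most [min (theta k * k) (t - k)] to the
    logarithm of the modulus divided by [e].  This is [entropy_profile].

    It remains to choose [theta].  For [theta k = beta / (1 - beta)] the function
    [min (theta k * k) (t - k) / t] of [t] has maximum [beta], attained at
    [t = k + theta k * k].  Taking [beta] close to [b] for [k] in the very sparse
    sequence [peak] brings the quotient near [b], without exceeding it; taking
    [beta = a] for all other [k] keeps the lower limit at least [a], and at a
    time [t] equal to a peak the earlier peaks have become negligible and only
    [a] is left ([upper_rate], [lower_rate]).  Approaching [b] by rates
    below it covers [b = 1], where [beta / (1 - beta)] would be infinite. *)

(** * Growth rate of separated sets *)

Section limsup.
Context {R : realType} {T : topologicalType}.
Variables (v : T -> \bar R) (F : set_system T).

Lemma limf_esup_le (FF : Filter F) (l : \bar R) :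
  (\forall x \near F, (v x <= l)%E) -> (limf_esup v F <= l)%E.
Proof.
move=> vl; rewrite limf_esupE.
apply: (@le_trans _ _ (ereal_sup (v @` [set x | (v x <= l)%E]))).
  by apply: ereal_inf_lbound; exists [set x | (v x <= l)%E].
by apply: ge_ereal_sup => _ [x /= vx <-].
Qed.

Lemma limf_esup_ge (l : \bar R) :
  (forall V, F V -> exists2 x, V x & (l <= v x)%E) -> (l <= limf_esup v F)%E.
Proof.
move=> vl; rewrite limf_esupE; apply: le_ereal_inf_tmp => _ [V FV <-].
have [x Vx /le_trans] := vl V FV; apply.
by apply: ereal_sup_ubound; exists x.
Qed.

End limsup.

Section separated_sets.
Context {R : realType} {X : metricType R}.
Implicit Types (phi : X -> X) (e : R).

Lemma dist_n_ge phi n i x y : (i < n)%N ->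
  mdist (iter i phi x) (iter i phi y) <= dist_n phi n x y.
Proof.
move=> ltin; rewrite /dist_n.
exact: (le_bigmax _ (fun j : 'I_n => mdist (iter j phi x) (iter j phi y))
          (Ordinal ltin)).
Qed.

Lemma dist_n_le phi n e x y : 0 <= e ->
  (forall i, (i < n)%N -> mdist (iter i phi x) (iter i phi y) <= e) ->
  dist_n phi n x y <= e.
Proof. by move=> e0 le_e; apply/bigmax_leP; split => // i _; exact: le_e. Qed.

Lemma sep_n_ge0 n phi e : (0 <= sep_n n phi e)%E.
Proof.
apply: ereal_sup_ubound; exists fset0; last by rewrite cardfs0.
by move=> x y; rewrite /= in_fset0.
Qed.

Lemma sep_le phi e (N D : nat) : (0 < N)%N -> (0 < D)%N ->
  (forall n, (sep_n n phi e <= (N * D ^ n)%:R%:E)%E) ->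
  (sep phi e <= (ln D%:R)%:E)%E.
Proof.
move=> N0 D0 le_ND; apply/lee_addgt0Pr => eta eta0.
apply: limf_esup_le; near=> n.
have n0 : (0 < n)%N by near: n; exact: nbhs_infty_gt.
have nR : 0 < n%:R :> R by rewrite ltr0n.
have NR : 0 < N%:R :> R by rewrite ltr0n.
have DR : 0 < D%:R :> R by rewrite ltr0n.
apply: (@le_trans _ _ ((n%:R^-1)%:E * lne (N * D ^ n)%:R%:E)%E).
  apply: lee_wpmul2l; first by rewrite lee_fin invr_ge0 ler0n.
  rewrite lee_lne ?in_itv /= ?leey ?andbT ?sep_n_ge0 //.
rewrite lne_EFin; last by rewrite ltr0n muln_gt0 N0 expn_gt0 D0.
rewrite -EFinM lee_fin natrM natrX lnM ?posrE ?exprn_gt0 // lnXn //.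
rewrite mulrC ler_pdivrMr //.
have : ln N%:R / eta <= n%:R.
  near: n; exact: nbhs_infty_ger.
rewrite ler_pdivrMr // -mulr_natr; lra.
Unshelve. all: by end_near. Qed.

Lemma sep_ge phi e (m : nat) : (0 < m)%N ->
  (forall n, ((m ^ n)%:R%:E <= sep_n n phi e)%E) ->
  ((ln m%:R)%:E <= sep phi e)%E.
Proof.
move=> m0 ge_m; apply: limf_esup_ge => V [N _ NV].
exists N.+1; first by apply: NV => /=.
have mR : 0 < m%:R :> R by rewrite ltr0n.
apply: (@le_trans _ _ ((N.+1%:R^-1)%:E * lne (m ^ N.+1)%:R%:E)%E); last first.
  apply: lee_wpmul2l; first by rewrite lee_fin invr_ge0 ler0n.
  rewrite lee_lne ?in_itv /= ?leey ?andbT ?sep_n_ge0 //.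
rewrite lne_EFin; last by rewrite ltr0n expn_gt0 m0.
rewrite -EFinM lee_fin natrX lnXn // -[X in _ * X]mulr_natl mulrA.
by rewrite mulVf ?mul1r ?pnatr_eq0.
Qed.

(** The points obtained by composing the inverse branches [psi] along the
    [m ^ n] words of length [n] follow pairwise distinct itineraries, and two
    points with different itineraries are at some time on different legs. *)
Lemma sep_n_ge_horseshoe phi e n m (Y : set X) (psi : 'I_m -> X -> X) (y0 : X) :
  0 <= e -> Y y0 ->
  (forall i y, Y y -> Y (psi i y)) ->
  (forall i y, Y y -> phi (psi i y) = y) ->
  (forall i j y z, Y y -> Y z -> i != j -> e < mdist (psi i y) (psi j z)) ->
  ((m ^ n)%:R%:E <= sep_n n phi e)%E.
Proof.
move=> e0 Yy0 Ypsi psiK far.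
pose pt (w : seq 'I_m) := foldr psi y0 w.
have Ypt w : Y (pt w) by elim: w => //= i w; exact: Ypsi.
have iter_pt j w : (j <= size w)%N -> iter j phi (pt w) = pt (drop j w).
  elim: j w => [|j IH] [|i w] //= ltj.
  by rewrite -iterS iterSr psiK // IH.
have far_pt (w w' : n.-tuple 'I_m) : w != w' -> e < dist_n phi n (pt w) (pt w').
  move=> neq; have [i neqi] : exists i, tnth w i != tnth w' i.
    apply/existsP; apply: contraNT neq; rewrite negb_exists => /forallP eqw.
    by apply/eqP/eq_from_tnth => i; apply/eqP; move: (eqw i); rewrite negbK.
  apply: lt_le_trans (dist_n_ge _ _ _ (ltn_ord i)).
  rewrite !iter_pt ?size_tuple 1?ltnW //.
  rewrite (drop_nth (tnth w i) (s := w)) ?size_tuple //.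
  rewrite (drop_nth (tnth w i) (s := w')) ?size_tuple //=.
  by apply: far => //; rewrite -!tnth_nth.
have pt_inj : injective (fun w : n.-tuple 'I_m => pt w).
  move=> w w' /= eqpt; apply/eqP; apply: contraT => /far_pt.
  rewrite eqpt ltNge dist_n_le // => i _.
  by rewrite mdistxx.
apply: ereal_sup_ubound.
exists [fset pt (w : n.-tuple 'I_m) | w in [set: n.-tuple 'I_m]%SET]%fset.
  move=> x y /= /imfsetP[w _ ->] /imfsetP[w' _ ->] neq.
  by apply: far_pt; apply: contra_notN neq => /eqP ->.
by rewrite card_imfset //= -cardE cardsT card_tuple card_ord.
Qed.

End separated_sets.

(** * Counting itineraries *)

Section itineraries.
Context {R : realType}.
Implicit Types (phi : unitI R -> unitI R) (e : R) (x y : unitI R).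

Lemma unitI_itv x : (0 : R) <= set_val x <= 1.
Proof. by have := set_valP x; rewrite /= in_itv. Qed.

Definition cell e x : nat := Num.truncn (set_val x / e).

Lemma cell_itv e x : 0 < e ->
  (cell e x)%:R * e <= set_val x < (cell e x)%:R * e + e.
Proof.
move=> e0; have /andP[x0 _] := unitI_itv x.
have /truncn_itv : 0 <= set_val x / e by rewrite divr_ge0 // ltW.
by rewrite -/(cell e x) ler_pdivlMr // ltr_pdivrMr // -natr1 mulrDl mul1r.
Qed.

Lemma cell_dist e x y : 0 < e -> cell e x = cell e y -> mdist x y < e.
Proof.
move=> e0 eqc; rewrite unitI_distE ltr_distl.
have := cell_itv x e0; have := cell_itv y e0; rewrite eqc.
by move=> /andP[] ? ? /andP[] ? ?; lra.
Qed.

Lemma dist_cell e x y (M : nat) : 0 < e -> mdist x y <= e * M%:R ->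
  (cell e x <= cell e y + M)%N.
Proof.
move=> e0; rewrite unitI_distE ler_distl => /andP[_ lexy].
rewrite -ltnS -(ltr_nat R) -natr1 natrD -(ltr_pM2r e0).
have := cell_itv x e0; have := cell_itv y e0.
by move=> /andP[] ? ? /andP[] ? ?; lra.
Qed.

(** An orbit is encoded by its first cell and, at each step, by the position of
    the next cell relative to a prediction made from the current cell alone:
    the image of a point [rep q] chosen once and for all in the cell [q].  Both
    the true and the predicted cell are within [M] of each other, whence
    [2 * M + 1] symbols, and the code determines all the cells by induction. *)
Lemma sep_n_le_modulus phi e n (M : nat) : 0 < e ->
  (forall x y, mdist x y < e -> mdist (phi x) (phi y) <= e * M%:R) ->
  (sep_n n phi e <= ((Num.truncn e^-1).+1 * (M.*2).+1 ^ n)%:R%:E)%E.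
Proof.
move=> e0 phiM; set N := Num.truncn _; apply: ge_ereal_sup => _ [A /= sepA <-].
rewrite lee_fin ler_nat; have [->|[x0 _]] := fset_0Vmem A; first by rewrite cardfs0.
pose rep q := xget x0 [set x | cell e x = q].
have repP x : cell e (rep (cell e x)) = cell e x.
  exact: (@xgetPex _ x0 [set y | cell e y = cell e x] (ex_intro _ x erefl)).
pose pred_cell x := cell e (phi (rep (cell e x))).
have pred_le x : (cell e (phi x) <= pred_cell x + M)%N.
  by apply/dist_cell/phiM/cell_dist => //; rewrite repP.
have pred_ge x : (pred_cell x <= cell e (phi x) + M)%N.
  by apply/dist_cell/phiM/cell_dist => //; rewrite repP.
pose jump x : 'I_(M.*2).+1 := inord (cell e (phi x) + M - pred_cell x).
pose code (x : A) : 'I_N.+1 * {ffun 'I_n -> 'I_(M.*2).+1} :=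
  (inord (cell e (val x)), [ffun i : 'I_n => jump (iter i phi (val x))]).
have code_inj : injective code.
  move=> x y [/(congr1 val) /= eq0 /ffunP eqj]; apply: contrapT => neq.
  have cell_le z : (cell e z <= N)%N.
    have /andP[_ z1] := unitI_itv z.
    by rewrite /cell /N; apply: le_truncn; rewrite ler_piMl // invr_ge0 ltW.
  move: eq0; rewrite !inordK ?ltnS // => eq0.
  have eqc i : (i <= n)%N ->
      cell e (iter i phi (val x)) = cell e (iter i phi (val y)).
    elim: i => // i IH lti.
    have := eqj (Ordinal lti); rewrite !ffunE /=.
    have := IH (ltnW lti).
    set u := iter i phi (val x); set v := iter i phi (val y) => eqc.
    have := (pred_le u, pred_ge u); have := (pred_le v, pred_ge v).
    rewrite /pred_cell eqc => -[le_v ge_v] [le_u ge_u] /(congr1 val).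
    by rewrite /jump /pred_cell eqc /= !inordK; lia.
  have : e < dist_n phi n (val x) (val y).
    by apply: sepA; rewrite /= ?fsvalP // => /val_inj.
  rewrite ltNge dist_n_le // ?ltW // => i /ltnW /eqc /(cell_dist e0) /ltW //.
rewrite cardfE (leq_trans (leq_card _ code_inj)) //.
by rewrite card_prod card_ffun !card_ord.
Qed.

End itineraries.

(** * Rates on a logarithmic scale *)

Section logarithmic_scale.
Context {R : realType}.
Implicit Types (S : R -> \bar R) (l : R).

Lemma near_0right_expR (P : set R) :
  (\forall e \near 0^'+, P e) <-> (exists T, forall t, T < t -> P (expR (- t))).
Proof.
split=> [|[T PT]].
  rewrite near_withinE => /nbhs_ballP[d /= d0 Pd]; exists (- ln d) => t lt_t.
  apply: Pd => /=; last exact: expR_gt0.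
  rewrite /ball /= sub0r normrN ger0_norm ?expR_ge0 //.
  by rewrite -[ltRHS](lnK d0) ltr_expR ltrNl.
near=> e.
have e0 : 0 < e by near: e; exact: nbhs_right_gt.
rewrite -(lnK e0) -[ln e]opprK; apply: PT.
rewrite ltrNr -ltr_expR lnK //; near: e; apply: nbhs_right_lt.
exact: expR_gt0.
Unshelve. all: by end_near. Qed.

Lemma div_ln_expR S t : 0 < t ->
  (S (expR (- t)) * (`|ln (expR (- t))|^-1)%:E = S (expR (- t)) * (t^-1)%:E)%E.
Proof. by move=> t0; rewrite expRK normrN gtr0_norm. Qed.

Let rate S := fun e : R => (S e * (`|ln e|^-1)%:E)%E.

Let rate_le S t l : 0 < t -> (S (expR (- t)) <= (l * t)%:E)%E ->
  (rate S (expR (- t)) <= l%:E)%E.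
Proof. by move=> t0; rewrite /rate div_ln_expR // lee_pdivrMr // -EFinM. Qed.

Let rate_ge S t l : 0 < t -> ((l * t)%:E <= S (expR (- t)))%E ->
  (l%:E <= rate S (expR (- t)))%E.
Proof. by move=> t0; rewrite /rate div_ln_expR // lee_pdivlMr // -EFinM. Qed.

Lemma limf_esup_rate_le S l :
  (forall eta : R, 0 < eta ->
     exists T, forall t, T < t -> (S (expR (- t)) <= ((l + eta) * t)%:E)%E) ->
  (limf_esup (rate S) 0^'+ <= l%:E)%E.
Proof.
move=> le_l; apply/lee_addgt0Pr => eta eta0; have [T leT] := le_l eta eta0.
apply: limf_esup_le; apply/near_0right_expR; exists (Num.max 0 T) => t.
by rewrite gt_max => /andP[t0 /leT]; exact: rate_le.
Qed.

Lemma limf_esup_rate_ge S l :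
  (forall eta T : R, 0 < eta ->
     exists2 t, T < t & (((l - eta) * t)%:E <= S (expR (- t)))%E) ->
  (l%:E <= limf_esup (rate S) 0^'+)%E.
Proof.
move=> ge_l; apply/lee_addgt0Pr => eta eta0; rewrite -leeBlDr //.
apply: limf_esup_ge => V /near_0right_expR[T VT].
have [t] := ge_l eta (Num.max 0 T) eta0.
rewrite gt_max => /andP[t0 /VT Vt] ge_t; exists (expR (- t)) => //.
exact: rate_ge.
Qed.

Lemma limf_einf_rate_ge S l :
  (forall eta : R, 0 < eta ->
     exists T, forall t, T < t -> (((l - eta) * t)%:E <= S (expR (- t)))%E) ->
  (l%:E <= limf_einf (rate S) 0^'+)%E.
Proof.
move=> ge_l; apply/lee_addgt0Pr => eta eta0; have [T geT] := ge_l eta eta0.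
rewrite -leeBlDr // /limf_einf leeNr.
apply: limf_esup_le; apply/near_0right_expR; exists (Num.max 0 T) => t.
by rewrite gt_max leeN2 => /andP[t0 /geT]; exact: rate_ge.
Qed.

Lemma limf_einf_rate_le S l :
  (forall eta T : R, 0 < eta ->
     exists2 t, T < t & (S (expR (- t)) <= ((l + eta) * t)%:E)%E) ->
  (limf_einf (rate S) 0^'+ <= l%:E)%E.
Proof.
move=> le_l; apply/lee_addgt0Pr => eta eta0; rewrite /limf_einf leeNl.
apply: limf_esup_ge => V /near_0right_expR[T VT].
have [t] := le_l eta (Num.max 0 T) eta0.
rewrite gt_max => /andP[t0 /VT Vt] le_t; exists (expR (- t)) => //.
by rewrite leeN2; exact: rate_le.
Qed.

End logarithmic_scale.

(** [S] stands for the growth rate of separated sets as a function of the scale,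
    which is written [expR (- t)].  In the first clause, [E] bounds the minimum of [theta k * k]
    and [t - k] for every [k]: a horseshoe at scale [expR (- k)] with
    [expR (theta k * k)] legs contributes no more.  In the second clause, [t] is
    past the point where its legs are separated. *)
Definition entropy_profile {R : realType} (theta : nat -> R) (S : R -> \bar R) :=
  exists C : R,
    (forall t E : R, 0 < t -> 0 <= E ->
       (forall k, theta k * k%:R <= E \/ t - k%:R <= E) ->
       (S (expR (- t)) <= (C + E)%:E)%E) /\
    (forall (t : R) k, k%:R + theta k * k%:R + C < t ->
       ((theta k * k%:R - C)%:E <= S (expR (- t)))%E).

(** Each peak is the cube of the previous one, so that the contribution of a
    peak, which is at most quadratic in it, is negligible at the next.  All
    peaks are even, which leaves every odd index to the rate [a]. *)
Definition peak (j : nat) : nat := 2 ^ 3 ^ j.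

Lemma peakS j : peak j.+1 = (peak j ^ 3)%N.
Proof. by rewrite /peak expnSr expnM. Qed.

Lemma peak_homo i j : (i <= j)%N -> (peak i <= peak j)%N.
Proof. by move=> leij; rewrite leq_exp2l // leq_exp2l. Qed.

Lemma peak_gt j : (j < peak j)%N.
Proof. by rewrite (ltn_trans (ltn_expl _ (isT : 1 < 3)%N)) // ltn_expl. Qed.

Lemma odd_peak j : odd (peak j) = false.
Proof. by rewrite /peak oddX orbF expn_eq0. Qed.

Section profile.
Context {R : realType} (a b : R).

(** The best value of the quotient of entropy by [t] that the [k]-th horseshoe
    can reach.  At a peak it tends to [b] but stays below, so that
    [leg_exponent] is finite even for [b = 1]. *)
Definition leg_rate (k : nat) : R :=
  if `[< exists j, k = peak j >] then b - (b - a) / k.+1%:R else a.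

Definition leg_exponent k := leg_rate k / (1 - leg_rate k).

Hypotheses (a0 : 0 <= a) (b1 : b <= 1) (ab : a < b).

Lemma leg_rate_ge k : a <= leg_rate k.
Proof.
rewrite /leg_rate; case: ifP => // _; rewrite lerBrDr -lerBrDl.
by rewrite ler_piMr ?subr_ge0 ?(ltW ab) // invf_le1 ?ltr0n // ler1n.
Qed.

Lemma leg_rate_lt k : leg_rate k < b.
Proof.
rewrite /leg_rate; case: ifP => // _; rewrite ltrBlDr ltrDl.
by rewrite divr_gt0 ?subr_gt0 ?ltr0n.
Qed.

Lemma leg_rate_lt1 k : leg_rate k < 1.
Proof. exact: lt_le_trans (leg_rate_lt k) b1. Qed.

Lemma leg_rate_ge0 k : 0 <= leg_rate k.
Proof. exact: le_trans a0 (leg_rate_ge k). Qed.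

Lemma leg_exponent_ge0 k : 0 <= leg_exponent k.
Proof. by rewrite divr_ge0 ?leg_rate_ge0 // subr_ge0 ltW // leg_rate_lt1. Qed.

(** Since [(1 - d) * leg_exponent k = d] for [d = leg_rate k], the two bounds
    [leg_exponent k * k] and [t - k], weighted by [1 - d] and [d], have
    average [d * t]; the smaller one is at most that. *)
Lemma ramp_le k c t : leg_rate k <= c -> 0 <= t ->
  leg_exponent k * k%:R <= c * t \/ t - k%:R <= c * t.
Proof.
move=> le_c t0; set x := k%:R; have x0 : 0 <= x by rewrite ler0n.
have := leg_rate_ge0 k; have := leg_rate_lt1 k.
rewrite /leg_exponent; set d := leg_rate k in le_c *; move=> d1 d0.
have [le_t|lt_t] := leP ((1 - d) * t) x; [right | left].
  have : d * t <= c * t by rewrite ler_wpM2r.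
  by move: le_t; rewrite mulrBl; lra.
rewrite (@le_trans _ _ (d * t)) ?ler_wpM2r //.
rewrite mulrAC ler_pdivrMr ?subr_gt0 // -mulrA ler_wpM2l // ltW //.
by rewrite mulrC.
Qed.

Lemma leg_exponent_rate k :
  leg_exponent k = leg_rate k * (1 + leg_exponent k).
Proof.
have := leg_rate_lt1 k; rewrite /leg_exponent => d1.
by field; rewrite subr_eq0 gt_eqF.
Qed.

(** No horseshoe exceeds [b * t] by [ramp_le]; at [t] just beyond
    [(1 + leg_exponent k) * k], with [k] a large peak, the [k]-th one reaches
    [leg_rate k * t], up to a constant. *)
Lemma upper_rate S : entropy_profile leg_exponent S ->
  limf_esup (fun e => S e * (`|ln e|^-1)%:E)%E 0^'+ = b%:E.
Proof.
move=> [C [upS loS]]; apply/eqP; rewrite eq_le; apply/andP; split.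
  apply: limf_esup_rate_le => eta eta0; exists (Num.max 0 (C / eta)) => t.
  rewrite gt_max => /andP[t0]; rewrite ltr_pdivrMr // => Ct.
  apply: (le_trans (upS t (b * t) t0 _ _)).
  - by rewrite mulr_ge0 ?(ltW t0) // (le_trans a0) // ltW.
  - by move=> k; apply: ramp_le; rewrite ?ltW // leg_rate_lt.
  - by rewrite lee_fin; lra.
apply: limf_esup_rate_ge => eta T eta0.
have [k [Tk ek Ck dE]] : exists k, [/\ Num.max T 0 < k%:R, 2 < k%:R * eta,
    4 * `|C| + 4 < k%:R * eta & leg_rate k = b - (b - a) / (k%:R + 1)].
  set M := Num.max (Num.max T 0) (Num.max (2 / eta) ((4 * `|C| + 4) / eta)).
  exists (peak (Num.truncn M)); set k := peak _.
  have : M < k%:R by rewrite (lt_le_trans (truncnS_gt M)) // ler_nat peak_gt.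
  rewrite !gt_max !ltr_pdivrMr // => /andP[-> /andP[-> ->]].
  by split=> //; rewrite /leg_rate asboolT -?natr1 //; exists (Num.truncn M).
have := leg_exponent_rate k; have := loS _ k.
have := leg_rate_lt1 k; have := leg_rate_ge0 k; have := leg_exponent_ge0 k.
move: dE Ck ek Tk; rewrite gt_max.
move: k%:R (leg_rate k) (leg_exponent k) => x d r dE Ck ek /andP[Tx x0].
move=> r0 d0 d1 S_ge rE.
have A0 := a0; have B1 := b1; have AB := ab.
have d_ge : b - eta / 2 <= d.
  by rewrite dE lerD2l lerN2 ler_pdivrMr; nra.
have rx0 : 0 <= r * x by rewrite mulr_ge0 // ltW.
have C0 := normr_ge0 C; have CC := ler_norm C.
exists (x + r * x + `|C| + 1); first by lra.
apply: le_trans (S_ge _ _); last by lra.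
rewrite lee_fin.
have : r * x = d * (x + r * x) by rewrite {1}rE; ring.
have : 0 <= (d - (b - eta / 2)) * (x + r * x).
  by rewrite mulr_ge0 ?subr_ge0 // addr_ge0 // ltW.
have : 0 <= (1 - (b - eta)) * (`|C| + 1) by rewrite mulr_ge0; lra.
have : 0 <= eta * (r * x) by rewrite mulr_ge0 // ltW.
by move: (r * x) => rx; lra.
Qed.

(** At [t] equal to a peak, the horseshoes of index at least [t] are invisible,
    those of the earlier peaks contribute [O(t ^ (2 / 3))], and the others at
    most [a * t].  For every large [t], an odd index close to [(1 - a) * t]
    gives [a * t - O(1)]. *)
Lemma lower_rate S : entropy_profile leg_exponent S ->
  limf_einf (fun e => S e * (`|ln e|^-1)%:E)%E 0^'+ = a%:E.
Proof.
have A0 := a0; have B1 := b1; have AB := ab; have a1 : 0 < 1 - a by lra.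
move=> [C [upS loS]]; apply/eqP; rewrite eq_le; apply/andP; split.
  apply: limf_einf_rate_le => eta T eta0.
  pose D := 2 / (1 - a); have D0 : 0 <= D by rewrite divr_ge0 // ltW.
  have [j [Tj j1 Cj]] : exists j, [/\ T < (peak j)%:R, 1 < (peak j)%:R :> R &
      `|C| + D < (peak j)%:R * eta].
    set M := Num.max (Num.max T 1) ((`|C| + D) / eta).
    exists (Num.truncn M).
    have : M < (peak (Num.truncn M))%:R.
      by rewrite (lt_le_trans (truncnS_gt M)) // ler_nat peak_gt.
    by rewrite !gt_max ltr_pdivrMr // => /andP[/andP[-> ->] ->].
  have tE : (peak j.+1)%:R = (peak j)%:R ^+ 3 :> R by rewrite peakS natrX.
  have E0 : 0 <= a * (peak j)%:R ^+ 3 + D * (peak j)%:R ^+ 2.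
    by rewrite addr_ge0 // mulr_ge0 // exprn_ge0.
  have t0 : 0 < (peak j)%:R ^+ 3 :> R by rewrite exprn_gt0 //; lra.
  exists ((peak j)%:R ^+ 3).
    rewrite (lt_le_trans Tj) // exprS ler_peMr // exprn_ege1 // ltW //.
  apply: (le_trans (upS _ _ t0 E0 _)).
  - move=> k; have [[i ki]|nk] := pselect (exists j, k = peak j); last first.
      have : leg_rate k <= a by rewrite /leg_rate asboolF.
      by move=> /ramp_le /(_ (ltW t0))[] le_at; [left | right];
        rewrite (le_trans le_at) // lerDl mulr_ge0.
    have [leij|ltji] := leqP i j; [left | right].
      rewrite (@le_trans _ _ (D * (peak j)%:R ^+ 2)) ?lerDr ?mulr_ge0 ?(ltW t0) //.
      have kq : k%:R <= (peak j)%:R :> R by rewrite ler_nat ki peak_homo.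
      have k0 : 0 <= k%:R :> R by [].
      have d1 : (1 - a) / (k%:R + 1) <= 1 - leg_rate k.
        rewrite /leg_rate asboolT; last by exists i.
        rewrite -natr1; clear -A0 B1 AB k0; move: k0; move: k%:R => x x0.
        have : (x + 1)^-1 <= 1 by rewrite invf_le1; lra.
        by move: (x + 1)^-1 => u u1; nra.
      rewrite /leg_exponent mulrAC ler_pdivrMr; last by rewrite subr_gt0 leg_rate_lt1.
      apply: (@le_trans _ _ (D * (peak j)%:R ^+ 2 * ((1 - a) / (k%:R + 1)))).
        have -> : D * (peak j)%:R ^+ 2 * ((1 - a) / (k%:R + 1)) =
                  2 * (peak j)%:R ^+ 2 / (k%:R + 1).
          by rewrite /D; field; rewrite ?gt_eqF //; lra.
        rewrite ler_pdivlMr; last by lra.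
        have := leg_rate_ge0 k; have := leg_rate_lt1 k; clear -k0 kq j1.
        move: k%:R (peak j)%:R (leg_rate k) k0 kq j1 => x q d x0 xq q1 d1 d0.
        have : d * x <= q by nra.
        by move: (d * x) => dx dxq; nra.
      by rewrite ler_wpM2l // mulr_ge0 ?exprn_ge0.
    rewrite (@le_trans _ _ 0) // subr_le0 -tE ler_nat ki peak_homo //.
  - rewrite lee_fin; have CC := ler_norm C; have C0 := normr_ge0 C.
    move: (peak j)%:R j1 Cj => q q1 Cq; clear -C0 CC q1 Cq D0 eta0.
    move: D D0 Cq => D D0 Cq; have q21 : 1 <= q ^+ 2 by nra.
    have : (`|C| + D) * q ^+ 2 <= eta * q ^+ 3.
      by rewrite [q ^+ 3]exprS; move: (q ^+ 2) q21 => q2 q21; nra.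
    by move: (q ^+ 2) (q ^+ 3) q21 => q2 q3 q21 H; nra.
apply: limf_einf_rate_ge => eta eta0.
have C0 := normr_ge0 C; have CC := ler_norm C.
(* odd indices are not peaks *)
pose r := a / (1 - a).
have r0 : 0 <= r by rewrite divr_ge0 // ltW.
have rE : r * (1 - a) = a by rewrite divfK // gt_eqF.
have regular j : leg_exponent j.*2.+1 = r.
  rewrite /leg_exponent /leg_rate asboolF // => -[i jE].
  by have := odd_peak i; rewrite -jE /= odd_double.
exists ((3 + `|C|) / (1 - a) + `|C| + (3 * r + a * `|C| + `|C|) / eta) => t lt_t.
have t_large : (3 + `|C|) / (1 - a) < t - `|C|.
  have : 0 <= (3 * r + a * `|C| + `|C|) / eta.
    by rewrite divr_ge0 ?(ltW eta0) // !addr_ge0 // mulr_ge0.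
  by lra.
have eta_t : 3 * r + a * `|C| + `|C| < t * eta.
  rewrite -ltr_pdivrMr //.
  have : 0 <= (3 + `|C|) / (1 - a) by rewrite divr_ge0 ?(ltW a1) // addr_ge0.
  by lra.
move: t_large; rewrite ltr_pdivrMr // => t_large.
(* the largest [j] with [2 * j + 1 <= (1 - a) * (t - |C|) - 1] *)
have y0 : 0 <= ((t - `|C|) * (1 - a) - 2) / 2 by lra.
have /andP[] := truncn_itv y0; set j := Num.truncn _ => jy yj.
have := loS t j.*2.+1; rewrite regular.
have : j.*2.+1%:R = 2 * j%:R + 1 :> R by rewrite -[LHS]natr1 -muln2 natrM mulrC.
move: jy yj; rewrite -[j.+1%:R]natr1.
move: j.*2.+1%:R (j%:R : R) => k x jy yj kE S_ge.
clear lt_t regular; move: r r0 rE eta_t S_ge => r r0 rE eta_t S_ge.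
have le_k : 0 <= (1 + r) * ((t - `|C|) * (1 - a) - 1 - k).
  by rewrite mulr_ge0 //; lra.
have ge_k : 0 <= r * (k - ((t - `|C|) * (1 - a) - 3)) by rewrite mulr_ge0 //; lra.
have rtE : r * ((t - `|C|) * (1 - a)) = a * (t - `|C|).
  by rewrite mulrCA rE mulrC.
by apply: le_trans (S_ge _); rewrite ?lee_fin; lra.
Qed.

End profile.

(** * Tents at all scales *)

Section tents.
Context {R : realType} (theta : nat -> R) (delta : R).
Hypotheses (theta_ge0 : forall k, 0 <= theta k) (delta_gt0 : 0 < delta).
Implicit Types (k i : nat) (u v y : R).

Definition height k : R := delta * expR (- k%:R).

Definition legs k : nat := Num.truncn (expR (theta k * k%:R)).

Definition half_width k : R := height k / (4 * (legs k)%:R).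

Definition centre k i : R := height k / 2 + (2 * i%:R + 1) * half_width k.

(** The slope is such that the tent vanishes at distance [half_width k] from
    its centre; the [legs k] tents of index [k] sit side by side on
    [[height k / 2, height k]]. *)
Definition tent k i u : R :=
  Num.max 0 (height k - 4 * (legs k)%:R * `|u - centre k i|).

(** As the supports of the tents have disjoint interiors this is also their sum;
    with a supremum, a modulus of continuity common to all tents is inherited
    without any discussion of where the points lie. *)
Definition tents u : R :=
  sup [set h | exists k i, (i < legs k)%N /\ h = tent k i u].

(** The inverse of the ascending half of [tent k i]. *)
Definition branch k i y : R :=
  centre k i - half_width k + y / (4 * (legs k)%:R).

Lemma height_gt0 k : 0 < height k.
Proof. by rewrite mulr_gt0 // expR_gt0. Qed.

Lemma height_le_delta k : height k <= delta.
Proof. by rewrite ler_piMr ?(ltW delta_gt0) // -expR0 ler_expR oppr_le0. Qed.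

(** The ratio [expR 1 >= 2] of successive heights puts the tents of different
    indices [k] over non-overlapping intervals. *)
Lemma height_half k k' : (k < k')%N -> height k' <= height k / 2.
Proof.
move=> ltk; have e2 : expR (- 1) <= 2^-1 :> R.
  rewrite expRN lef_pV2 ?posrE ?expR_gt0 // (le_trans _ (expR_ge1Dx _)) //.
have : height k.+1 <= height k / 2.
  rewrite /height -natr1 opprD expRD mulrA ler_wpM2l //.
  by rewrite ltW // mulr_gt0 ?expR_gt0.
apply: le_trans; rewrite ler_wpM2l ?(ltW delta_gt0) // ler_expR lerN2.
by rewrite ler_nat.
Qed.

Lemma legs_gt0 k : (0 < legs k)%N.
Proof. by rewrite truncn_gt0 -expR0 ler_expR mulr_ge0. Qed.

Lemma legs_le k : (legs k)%:R <= expR (theta k * k%:R).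
Proof. by rewrite truncn_le expR_ge0. Qed.

Lemma legs_ge k : expR (theta k * k%:R) <= 2 * (legs k)%:R.
Proof.
rewrite (le_trans (ltW (truncnS_gt _))) // -natrM ler_nat mul2n -addnn.
by rewrite -addn1 leq_add2l legs_gt0.
Qed.

Lemma slope_gt0 k : 0 < 4 * (legs k)%:R :> R.
Proof. by rewrite mulr_gt0 // ltr0n legs_gt0. Qed.

Lemma half_width_gt0 k : 0 < half_width k.
Proof. by rewrite divr_gt0 ?height_gt0 ?slope_gt0. Qed.

Lemma heightE k : height k = 4 * (legs k)%:R * half_width k.
Proof. by rewrite mulrC divfK // gt_eqF // slope_gt0. Qed.

Lemma tent_ge0 k i u : 0 <= tent k i u.
Proof. by rewrite le_max lexx. Qed.

Lemma tent_le_height k i u : tent k i u <= height k.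
Proof.
rewrite ge_max (ltW (height_gt0 k)) /= lerBlDr lerDl.
by rewrite mulr_ge0 // ltW // slope_gt0.
Qed.

Lemma tent_lipschitz k i u v :
  tent k i u <= tent k i v + 4 * (legs k)%:R * `|u - v|.
Proof.
have s0 := slope_gt0 k.
rewrite ge_max addr_ge0 ?tent_ge0 ?mulr_ge0 ?(ltW s0) //=.
apply: (@le_trans _ _ (height k - 4 * (legs k)%:R * `|v - centre k i|
                       + 4 * (legs k)%:R * `|u - v|)); last first.
  by rewrite lerD2r le_max lexx orbT.
have := ler_distD u v (centre k i); rewrite (distrC v u).
move: (4 * _) s0 `|_| `|_| `|_| => s s0 x y z; nra.
Qed.

Lemma tent_eq0 k i u : half_width k <= `|u - centre k i| -> tent k i u = 0.
Proof.
by move=> le_w; apply/max_idPl; rewrite subr_le0 heightE ler_wpM2l.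
Qed.

Lemma leg_itv k i : (i < legs k)%N ->
  height k / 2 <= centre k i - half_width k /\
  centre k i + half_width k <= height k.
Proof.
move=> lti; have w0 := half_width_gt0 k; split.
  have : 0 <= i%:R * half_width k by rewrite mulr_ge0 // ltW.
  by rewrite /centre; lra.
have : 0 <= ((legs k)%:R - (i%:R + 1)) * half_width k.
  by rewrite mulr_ge0 ?(ltW w0) // subr_ge0 natr1 ler_nat.
by have := heightE k; rewrite /centre; lra.
Qed.

Lemma tent_out k i u : (i < legs k)%N ->
  u <= height k / 2 \/ height k <= u -> tent k i u = 0.
Proof.
move=> /leg_itv[le_l le_r] out; apply: tent_eq0.
have := ler_norm (u - centre k i); rewrite distrC.
have := ler_norm (centre k i - u); lra.
Qed.

Lemma branch_itv k i y : (i < legs k)%N -> 0 <= y <= height k ->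
  centre k i - half_width k <= branch k i y <= centre k i.
Proof.
move=> lti /andP[y0 y1]; have s0 := slope_gt0 k; apply/andP; split.
  by rewrite lerDl divr_ge0 // ltW.
have : y / (4 * (legs k)%:R) <= half_width k by rewrite ler_wpM2r ?invr_ge0 // ltW.
by rewrite /branch; lra.
Qed.

Lemma centre_sep k i j : (i < j)%N ->
  centre k i + 2 * half_width k <= centre k j.
Proof.
move=> ltij; have w0 := half_width_gt0 k.
have : 0 <= (j%:R - (i%:R + 1)) * half_width k.
  by rewrite mulr_ge0 ?(ltW w0) // subr_ge0 natr1 ler_nat.
by rewrite /centre; lra.
Qed.

(** The ascending half of a tent leaves out its descending half, which separates
    it from the next one by [half_width k]. *)
Lemma branch_sep k i j y z : (i < legs k)%N -> (j < legs k)%N -> i != j ->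
  0 <= y <= height k -> 0 <= z <= height k ->
  half_width k <= `|branch k i y - branch k j z|.
Proof.
move=> lti ltj; rewrite neq_ltn => ltij Yy Yz.
have /andP[] := branch_itv lti Yy; have /andP[] := branch_itv ltj Yz.
have := ler_norm (branch k i y - branch k j z).
have := ler_norm (branch k j z - branch k i y); rewrite distrC.
by case/orP: ltij => /(centre_sep k) /= *; lra.
Qed.

Lemma tents_ubound u :
  ubound [set h | exists k i, (i < legs k)%N /\ h = tent k i u] delta.
Proof.
move=> _ [k [i [_ ->]]]; exact: le_trans (tent_le_height _ _ _) (height_le_delta _).
Qed.

Lemma tent_le_tents k i u : (i < legs k)%N -> tent k i u <= tents u.
Proof.
move=> lti; apply: ub_le_sup; first by exists delta; exact: tents_ubound.
by exists k, i.
Qed.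

Lemma tents_le u y : (forall k i, (i < legs k)%N -> tent k i u <= y) ->
  tents u <= y.
Proof.
move=> le_y; apply: ge_sup; last by move=> _ [k [i [lti ->]]]; exact: le_y.
by exists (tent 0 0 u), 0%N, 0%N; rewrite legs_gt0.
Qed.

Lemma tents_itv u : 0 <= tents u <= delta.
Proof.
rewrite (le_trans (tent_ge0 0 0 u)) ?tent_le_tents ?legs_gt0 //=.
by apply: tents_le => k i lti; apply: tents_ubound; exists k, i.
Qed.

Lemma tents_modulus u v y :
  (forall k, 4 * (legs k)%:R * `|u - v| <= y \/ height k <= y) ->
  `|tents u - tents v| <= y.
Proof.
move=> le_y.
have half u' v' : `|u' - v'| = `|u - v| -> tents u' <= tents v' + y.
  move=> eq_uv; apply: tents_le => k i lti.
  have lev := tent_le_tents v' lti; have s0 := slope_gt0 k.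
  have [le_yk|le_yk] := le_y k.
    by rewrite (le_trans (tent_lipschitz k i u' v')) // lerD // eq_uv.
  rewrite (le_trans (tent_le_height k i u')) // (le_trans le_yk) // lerDr.
  by case/andP: (tents_itv v').
have le_vu : tents v <= tents u + y by apply: half; rewrite distrC.
by rewrite ler_distl lerBlDr le_vu half.
Qed.

Lemma tents_branch k i y : (i < legs k)%N -> 0 <= y <= height k ->
  tents (branch k i y) = y.
Proof.
move=> lti Yy; have /andP[y0 y1] := Yy; have s0 := slope_gt0 k.
have /andP[b_ge b_le] := branch_itv lti Yy.
have [l_ge l_le] := leg_itv lti; have w0 := half_width_gt0 k.
have tentE : tent k i (branch k i y) = y.
  rewrite /tent ler0_norm ?subr_le0 // /branch.
  set s := 4 * _ in s0 *; rewrite (_ : height k - _ = y); first exact/max_idPr.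
  by rewrite heightE -/s; field; rewrite gt_eqF.
apply/eqP; rewrite eq_le; apply/andP; split; last by rewrite -{1}tentE tent_le_tents.
apply: tents_le => k' j ltj; have [->|neqk] := eqVneq k' k.
  have [->|neqj] := eqVneq j i; first by rewrite tentE.
  rewrite tent_eq0 //; have := ler_norm (branch k i y - centre k j).
  have := ler_norm (centre k j - branch k i y); rewrite distrC.
  by move: neqj; rewrite neq_ltn => /orP[/(centre_sep k)|/(centre_sep k)]; lra.
rewrite tent_out //.
by move: neqk; rewrite neq_ltn => /orP[/height_half|/height_half]; [left|right]; lra.
Qed.

End tents.

(** * Lipschitz approximation on the unit interval *)

Section unit_interval.
Context {R : realType}.

Lemma zero_unitI : (0 : R) \in (`[0, 1]%classic : set R).
Proof. by rewrite inE /= in_itv /= lexx ler01. Qed.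

Definition to_unitI : R -> unitI R := insubd (exist _ 0 zero_unitI : unitI R).

Lemma to_unitIK (r : R) : 0 <= r <= 1 -> set_val (to_unitI r) = r.
Proof.
move=> r01; rewrite /to_unitI set_valE insubdK //.
by rewrite inE /= in_itv.
Qed.

Lemma unitI_continuous_dist (f : unitI R -> unitI R) :
  (forall x e, 0 < e -> exists2 d : R, 0 < d &
     forall y, mdist x y < d -> mdist (f x) (f y) < e) -> continuous f.
Proof.
move=> cf x A /nbhs_ballP[e /= e0 fA]; have [d d0 fd] := cf x e e0.
by apply/nbhs_ballP; exists d => // y /= xy; apply: fA; exact: fd.
Qed.

Lemma C0I_unif_continuous (f : C0I R) (eta : R) : 0 < eta ->
  exists2 d : R, 0 < d &
    forall x y, mdist x y < d -> mdist (C0I_fun f x) (C0I_fun f y) < eta.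
Proof.
move=> eta0.
pose P (d : R) (x : unitI R) :=
  forall y, mdist x y < d -> mdist (C0I_fun f x) (C0I_fun f y) < eta.
have : \forall d \near 0^'+, [set: unitI R] `<=` P d.
  apply: (compact_near_coveringP _).1 => [|x _]; first exact: unitI_compact.
  have cf : continuous (C0I_fun f) by exact: (@cts_fun _ _ (f : continuousType _ _)).
  have /cf/nbhs_ballP[r /= r0 fr] :
      nbhs (C0I_fun f x) (ball (C0I_fun f x) (eta / 2)).
    by apply: nbhsx_ballx; rewrite divr_gt0.
  have r20 : 0 < r / 2 by rewrite divr_gt0.
  exists (ball x (r / 2), [set d : R | d <= r / 2]).
    split => /=; first exact: nbhsx_ballx.
    exact: nbhs_right_le.
  move=> [z d] /= [xz dr] y zy.
  have lt_r w : mdist x w < r -> mdist (C0I_fun f x) (C0I_fun f w) < eta / 2.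
    exact: fr.
  have {}xz : mdist x z < r / 2 := xz.
  rewrite (le_lt_trans (metric_triangle _ (C0I_fun f x) _)) //.
  rewrite [ltRHS](splitr eta) ltrD //; first by rewrite metric_sym lt_r //; lra.
  by rewrite lt_r // (le_lt_trans (metric_triangle _ z _)) //; lra.
move=> Pd; near (0 : R)^'+ => d.
exists d; first by near: d; exact: nbhs_right_gt.
move=> x; have : [set: unitI R] `<=` P d by near: d.
exact.
Unshelve. all: by end_near. Qed.

(** The infimal convolution of [f] with [L * |.|] is [L]-Lipschitz and at most
    [f].  With [L = d^-1], where [d] is a modulus of uniform continuity of [f]
    for [eta], a point at distance at least [d] contributes at least [1 >= f],
    and a closer one at least [f - eta]. *)
Lemma lipschitz_approx (f : C0I R) (eta : R) : 0 < eta ->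
  exists2 L : R, 0 <= L & exists2 g : R -> R,
    (forall u v, `|g u - g v| <= L * `|u - v|) &
    (forall x : unitI R, 0 <= g (set_val x) <= 1 /\
        `|g (set_val x) - set_val (C0I_fun f x)| <= eta).
Proof.
move=> eta0; have [d d0 fd] := C0I_unif_continuous f eta0.
exists d^-1; first by rewrite invr_ge0 ltW.
pose V (u : R) :=
  [set set_val (C0I_fun f y) + d^-1 * `|u - set_val y| | y in [set: unitI R]].
have V0 u : V u !=set0 by eexists; exists (to_unitI 0).
have Vge0 u : lbound (V u) 0.
  move=> _ [y _ <-]; have /andP[f0 _] := unitI_itv (C0I_fun f y).
  by rewrite addr_ge0 // mulr_ge0 // invr_ge0 ltW.
have infV u y : inf (V u) <= set_val (C0I_fun f y) + d^-1 * `|u - set_val y|.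
  by apply: ge_inf; [exists 0; exact: Vge0 | exists y].
exists (fun u => inf (V u)).
  have half u v : inf (V u) <= inf (V v) + d^-1 * `|u - v|.
    rewrite -lerBlDr; apply: lb_le_inf => // _ [y _ <-].
    rewrite lerBlDr (le_trans (infV u y)) // -addrA lerD2l -mulrDr.
    rewrite ler_wpM2l ?invr_ge0 ?(ltW d0) //.
    by rewrite [leRHS]addrC; exact: ler_distD.
  by move=> u v; rewrite ler_distl lerBlDr {1}distrC !half.
move=> x; have /andP[f0 f1] := unitI_itv (C0I_fun f x).
have le_f : inf (V (set_val x)) <= set_val (C0I_fun f x).
  by have := infV (set_val x) x; rewrite subrr normr0 mulr0 addr0.
split; first by rewrite lb_le_inf //= (le_trans le_f).
rewrite ler0_norm ?subr_le0 // opprB lerBlDl -lerBlDr.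
apply: lb_le_inf => // _ [y _ <-].
have /andP[fy0 fy1] := unitI_itv (C0I_fun f y).
have [xy|xy] := ltP (mdist x y) d.
  have := fd _ _ xy; rewrite !unitI_distE ltr_distl => /andP[_ lt_f].
  have : 0 <= d^-1 * `|set_val x - set_val y| by rewrite mulr_ge0 ?invr_ge0 // ltW.
  by lra.
have : 1 <= d^-1 * `|set_val x - set_val y|.
  by rewrite mulrC ler_pdivlMr // mul1r.
by lra.
Qed.

Lemma lipschitz_continuous (g : R -> R) (L : R) : 0 <= L ->
  (forall u v, `|g u - g v| <= L * `|u - v|) -> continuous g.
Proof.
move=> L0 gL u; apply/cvgrPdist_lt => e e0.
near=> v; rewrite (le_lt_trans (gL u v)) //.
have : `|u - v| < e / (L + 1).
  near: v; apply: cvgr_dist_lt => //; rewrite divr_gt0 //; lra.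
rewrite ltr_pdivlMr; last lra.
have := normr_ge0 (u - v); move: `|u - v| => w w0 H; nra.
Unshelve. all: by end_near. Qed.

End unit_interval.

(** * Inserting the tents at a fixed point *)

(** The tents of large index are low, and there are finitely many others. *)
Lemma tents_unif_continuous {R : realType} (theta : nat -> R) (delta e : R) :
  (forall k, 0 <= theta k) -> 0 < delta -> 0 < e ->
  exists2 d : R, 0 < d & forall u v, `|u - v| < d ->
    `|tents theta delta u - tents theta delta v| <= e.
Proof.
move=> theta_ge0 delta0 e0.
pose K := (Num.truncn (delta / e)).+1; pose M := (\max_(k < K) legs theta k)%N.
exists (e / (4 * M.+1%:R)); first by rewrite divr_gt0 // mulr_gt0.
move=> u v; rewrite ltr_pdivlMr ?mulr_gt0 // mulrC => lt_uv.
apply: tents_modulus => // k; have [ltkK|leKk] := ltnP k K; [left | right].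
  rewrite (le_trans _ (ltW lt_uv)) // ler_wpM2r // ler_wpM2l // ler_nat.
  by rewrite leqW // (leq_bigmax (F := fun k : 'I_K => legs theta k) (Ordinal ltkK)).
rewrite /height expRN ler_pdivrMr ?expR_gt0 // mulrC -ler_pdivrMr //.
rewrite (le_trans (ltW (truncnS_gt _))) //.
rewrite (le_trans _ (expR_ge1Dx _)) // -[X in X <= _]add0r lerD // ler_nat //.
Qed.

Section perturbation.
Context {R : realType} (g : R -> R) (L eta p delta : R) (theta : nat -> R).
Hypotheses (L0 : 0 <= L) (gL : forall u v, `|g u - g v| <= L * `|u - v|)
  (g_itv : forall u : R, 0 <= u <= 1 -> 0 <= g u <= 1 - eta)
  (p_itv : 0 <= p <= 1 - eta) (gp : g p = p)
  (delta_gt0 : 0 < delta) (delta_eta : delta <= eta) (delta_le1 : delta <= 1)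
  (theta_ge0 : forall k, 0 <= theta k).

(** The monotone map that is the identity up to [p], sends [[p, p + delta]] to
    [p], and is a translation by [- delta] beyond. *)
Definition collapse u : R := Num.max (Num.min u p) (u - delta).

Definition perturbed u : R := g (collapse u) + tents theta delta (u - p).

Definition perturbed_map (x : unitI R) : unitI R :=
  to_unitI (perturbed (set_val x)).

Lemma collapse_plateau v : 0 <= v <= delta -> collapse (p + v) = p.
Proof.
move=> /andP[v0 v1]; rewrite /collapse min_r ?lerDl //.
by rewrite max_l // -addrA gerDl subr_le0.
Qed.

Lemma collapse_itv u : u - delta <= collapse u <= u.
Proof.
have D0 := delta_gt0.
by rewrite /collapse le_max lexx orbT ge_max ge_min lexx /= gerBl ltW.
Qed.

Lemma collapse_ge0 u : 0 <= u -> 0 <= collapse u.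
Proof. by move=> u0; rewrite /collapse le_max le_min u0; case/andP: p_itv => ->. Qed.

Lemma collapse_lipschitz u v : `|collapse u - collapse v| <= `|u - v|.
Proof.
have half u' v' : collapse u' <= collapse v' + `|u' - v'|.
  have := ler_norm (u' - v'); have := normr_ge0 (u' - v').
  move: `|u' - v'| => w w0 le_w.
  rewrite /collapse /Num.max /Num.min; do !case: ifPn; rewrite -?leNgt => *; lra.
by rewrite ler_distl lerBlDr {1}distrC !half.
Qed.

Lemma perturbed_itv u : 0 <= u <= 1 -> 0 <= perturbed u <= 1.
Proof.
move=> /andP[u0 u1]; have /andP[_ cu] := collapse_itv u.
have /andP[g0 g1] : 0 <= g (collapse u) <= 1 - eta.
  by apply: g_itv; rewrite collapse_ge0 // (le_trans cu).
have /andP[t0 t1] := tents_itv theta_ge0 delta_gt0 (u - p).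
by rewrite addr_ge0 // /perturbed -[leRHS](subrK eta) lerD // (le_trans t1).
Qed.

Lemma perturbed_mapE x : set_val (perturbed_map x) = perturbed (set_val x).
Proof. by rewrite to_unitIK // perturbed_itv // unitI_itv. Qed.

Lemma perturbed_modulus u v :
  `|perturbed u - perturbed v| <=
    L * `|u - v| + `|tents theta delta (u - p) - tents theta delta (v - p)|.
Proof.
rewrite /perturbed opprD addrACA (le_trans (ler_normD _ _)) // lerD2r.
by rewrite (le_trans (gL _ _)) // ler_wpM2l // collapse_lipschitz.
Qed.

Lemma perturbed_map_continuous : continuous perturbed_map.
Proof.
have L1 := L0; apply: unitI_continuous_dist => x e e0.
have e40 : 0 < e / 4 by rewrite divr_gt0.
have [d d0 tents_d] := tents_unif_continuous theta_ge0 delta_gt0 e40.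
exists (Num.min d (e / (4 * (L + 1)))).
  by rewrite lt_min d0 divr_gt0 // mulr_gt0 //; lra.
move=> y; rewrite !unitI_distE !perturbed_mapE lt_min => /andP[xy_d].
rewrite ltr_pdivlMr; last by rewrite mulr_gt0 //; lra.
move=> xy_L; rewrite (le_lt_trans (perturbed_modulus _ _)) //.
have := tents_d (set_val x - p) (set_val y - p).
rewrite opprB addrA subrK => /(_ xy_d).
have := normr_ge0 (set_val x - set_val y); move: xy_L.
by move: `|set_val x - _| `|tents _ _ _ - _| => w s *; nra.
Qed.

Lemma perturbed_close u :
  `|perturbed u - g u| <= L * delta + delta.
Proof.
have /andP[c_ge c_le] := collapse_itv u.
have /andP[t0 t1] := tents_itv theta_ge0 delta_gt0 (u - p).
rewrite /perturbed addrAC (le_trans (ler_normD _ _)) // lerD //.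
  rewrite (le_trans (gL _ _)) // ler_wpM2l //.
  by rewrite ler0_norm ?subr_le0 // opprB lerBlDl -lerBlDr.
by rewrite ger0_norm.
Qed.

(** On [[p, p + delta]] the map is, in the coordinate [u - p], the function
    [tents] alone, since [g] is collapsed there to its fixed point. *)
Lemma perturbed_leg k i y : (i < legs theta k)%N -> 0 <= y <= height delta k ->
  perturbed (p + branch theta delta k i y) = p + y.
Proof.
move=> lti Yy; have /andP[b_ge b_le] := branch_itv theta_ge0 lti Yy.
have [l_ge l_le] := leg_itv theta_ge0 delta_gt0 lti.
have w0 := half_width_gt0 theta_ge0 delta_gt0 k.
have h0 := height_gt0 delta_gt0 k; have h1 := height_le_delta delta_gt0 k.
rewrite /perturbed collapse_plateau ?gp; last by apply/andP; split; lra.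
by rewrite [p + branch _ _ _ _ _]addrC addrK tents_branch.
Qed.

(** The modulus of continuity at scale [e = expR (- t)] is at most
    [e * (L + 4 * expR E)]: the tents of index [k] have slope
    [4 * legs k <= 4 * expR (theta k * k)] and height at most
    [expR (- k) = e * expR (t - k)]. *)
Lemma perturbed_sep_le t E : 0 < t -> 0 <= E ->
  (forall k, theta k * k%:R <= E \/ t - k%:R <= E) ->
  (sep perturbed_map (expR (- t)) <= (ln (2 * L + 11) + E)%:E)%E.
Proof.
move=> t0 E0 le_E; set e := expR (- t); have e0 : 0 < e by exact: expR_gt0.
have F0 : 1 <= expR E by rewrite -expR0 ler_expR.
pose M := (Num.truncn (L + 4 * expR E)).+1.
have LM : L + 4 * expR E <= M%:R by rewrite ltW // truncnS_gt.
have phiM x y : mdist x y < e ->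
    mdist (perturbed_map x) (perturbed_map y) <= e * M%:R.
  rewrite !unitI_distE !perturbed_mapE => xy.
  rewrite (le_trans (perturbed_modulus _ _)) //.
  rewrite (@le_trans _ _ (e * (L + 4 * expR E))) ?ler_wpM2l ?(ltW e0) //.
  rewrite mulrDr [e * L]mulrC lerD ?ler_wpM2l ?(ltW xy) //.
  apply: tents_modulus => // k; rewrite opprB addrA subrK.
  case: (le_E k) => le_k; [left | right].
    rewrite mulrA [e * 4]mulrC -mulrA -mulrA ler_wpM2l // mulrC.
    by rewrite ler_pM // ?(ltW xy) // (le_trans (legs_le _ _)) // ler_expR.
  rewrite /height /e mulrCA -expRD; apply: (@le_trans _ _ (expR (- k%:R))).
    by rewrite ler_piMl ?expR_ge0.
  apply: (@le_trans _ _ (expR (- t + E))); first by rewrite ler_expR; lra.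
  by rewrite ler_peMl ?expR_ge0 // ler1n.
apply: (@le_trans _ _ (ln (M.*2.+1)%:R)%:E).
  apply: (@sep_le _ _ _ _ (Num.truncn e^-1).+1) => // n.
  exact: sep_n_le_modulus.
rewrite lee_fin -(expRK E) -lnM ?posrE ?expR_gt0 //; last first.
  by have := L0; lra.
rewrite ler_ln ?posrE ?ltr0n //; last by rewrite mulr_gt0 ?expR_gt0 //; have := L0; lra.
have : M%:R <= L + 4 * expR E + 1.
  rewrite /M -natr1 lerD2r truncn_le addr_ge0 // mulr_ge0 // expR_ge0.
rewrite -[M.*2.+1%:R]natr1 -muln2 natrM; have := L0.
by move: M%:R (expR E) F0 => m F F0 ? ?; nra.
Qed.

(** The legs are the ascending halves of the [legs k] tents of index [k], and
    the two constants make up for [half_width k] against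
    [expR (- k - theta k * k)] and for [legs k] against [expR (theta k * k)]. *)
Lemma perturbed_sep_ge t k :
  k%:R + theta k * k%:R + (ln (4 / delta) + ln 2) < t ->
  ((theta k * k%:R - (ln (4 / delta) + ln 2))%:E <=
     sep perturbed_map (expR (- t)))%E.
Proof.
move=> lt_t.
have ln4 : 0 <= ln (4 / delta).
  by rewrite ln_ge0 // ler_pdivlMr // mul1r (le_trans delta_le1) // ler1n.
have ln2 : 0 <= ln 2 :> R by rewrite ln_ge0 // ler1n.
have m0 := legs_gt0 theta_ge0 k.
apply: (@le_trans _ _ (ln (legs theta k)%:R)%:E).
  rewrite lee_fin lerBlDr -[theta k * _]expRK.
  apply: (@le_trans _ _ (ln (2 * (legs theta k)%:R))).
    by rewrite ler_ln ?posrE ?expR_gt0 ?mulr_gt0 ?ltr0n // legs_ge.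
  by rewrite lnM ?posrE ?ltr0n //; lra.
apply: sep_ge => // n.
pose Y := [set x : unitI R | p <= set_val x <= p + height delta k].
have [h0 h1] := (height_gt0 delta_gt0 k, height_le_delta delta_gt0 k).
have to_Y v : 0 <= v <= height delta k -> set_val (to_unitI (p + v)) = p + v.
  have /andP[p0 p1] := p_itv; have := delta_eta.
  by move=> ? /andP[v0 v1]; apply: to_unitIK; apply/andP; split; lra.
have Y_itv x : Y x -> 0 <= set_val x - p <= height delta k.
  by move=> /andP[x0 x1]; rewrite subr_ge0 x0 lerBlDl.
pose psi (i : 'I_(legs theta k)) (x : unitI R) : unitI R :=
  to_unitI (p + branch theta delta k i (set_val x - p)).
have br_itv (i : 'I_(legs theta k)) x : Y x ->
    0 <= branch theta delta k i (set_val x - p) <= height delta k.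
  move=> /Y_itv /(branch_itv theta_ge0 (ltn_ord i)) /andP[b0 b1].
  have [l_ge l_le] := leg_itv theta_ge0 delta_gt0 (ltn_ord i).
  have w0 := half_width_gt0 theta_ge0 delta_gt0 k.
  by apply/andP; split; lra.
apply: (@sep_n_ge_horseshoe _ _ _ _ _ _ Y psi (to_unitI (p + 0))).
- exact: expR_ge0.
- by rewrite /Y /= to_Y ?lexx ?(ltW h0) // addr0 lexx lerDl ltW.
- move=> i x /(br_itv i) /[dup] /to_Y psiE; rewrite /Y /= psiE => /andP[b0 b1].
  by rewrite lerDl b0 lerD2l.
- move=> i x Yx; apply: val_inj.
  have := perturbed_leg (ltn_ord i) (Y_itv x Yx).
  rewrite -(to_Y _ (br_itv i x Yx)) -perturbed_mapE.
  rewrite [p + (_ - _)]addrC subrK.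
  by rewrite !set_valE.
- move=> i j x y Yx Yy neq.
  rewrite unitI_distE !to_Y ?br_itv // opprD addrACA subrr add0r.
  apply: lt_le_trans (branch_sep theta_ge0 delta_gt0 (ltn_ord i) (ltn_ord j) neq
    (Y_itv x Yx) (Y_itv y Yy)).
  rewrite /half_width ltr_pdivlMr ?slope_gt0 // /height.
  apply: (@le_lt_trans _ _ (expR (- t) * (4 * expR (theta k * k%:R)))).
    by rewrite ler_wpM2l ?expR_ge0 // ler_wpM2l // legs_le.
  rewrite (_ : 4 = delta * expR (ln (4 / delta))); last first.
    by rewrite lnK ?posrE ?divr_gt0 // mulrC divfK // gt_eqF.
  by rewrite -mulrA mulrCA ltr_pM2l // -!expRD ltr_expR; lra.
Qed.

End perturbation.

(** * Density *)

Section approximation.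
Context {R : realType}.

Lemma lipschitz_fixed_point (g : R -> R) (L c : R) : 0 <= L -> c <= 1 ->
  (forall u v, `|g u - g v| <= L * `|u - v|) ->
  (forall u : R, 0 <= u <= 1 -> 0 <= g u <= c) ->
  exists2 p : R, 0 <= p <= c & g p = p.
Proof.
move=> L0 c1 gL g_itv.
have I0 : (0 : R) <= (0 : R) <= 1 by rewrite lexx ler01.
have I1 : (0 : R) <= (1 : R) <= 1 by rewrite lexx ler01.
have /andP[g00 g0c] := g_itv 0 I0; have /andP[g10 g1c] := g_itv 1 I1.
have [] := @IVT R (fun u => g u - u) 0 1 0 ler01.
- apply: continuous_subspaceT => u.
  apply: cvgB; last exact: cvg_id.
  exact: (lipschitz_continuous L0 gL).
- by rewrite ge_min le_max subr0 g00 /= subr_le0 (le_trans g1c c1) orbT.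
move=> p; rewrite in_itv /= => /g_itv gp /eqP; rewrite subr_eq0 => /eqP gpE.
by exists p; rewrite // -gpE.
Qed.

Lemma dense_entropy_profile (theta : nat -> R) (f : C0I R) (r : R) :
  (forall k, 0 <= theta k) -> 0 < r ->
  exists2 phi : C0I R, mdist f phi < r &
    entropy_profile theta (sep (C0I_fun phi)).
Proof.
move=> theta0 r0; pose eta := Num.min (r / 4) (1 / 2).
have [eta0 eta_r eta1] : [/\ 0 < eta, eta <= r / 4 & eta <= 1 / 2].
  by rewrite /eta lt_min !ge_min !lexx orbT !divr_gt0.
clearbody eta; have [L L0 [g gL g_close]] := lipschitz_approx f eta0.
pose h u := (1 - eta) * g u.
have hL u v : `|h u - h v| <= L * `|u - v|.
  rewrite /h -mulrBr normrM ger0_norm; last lra.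
  by rewrite (le_trans _ (gL u v)) // ler_piMl //; lra.
have g_itv u : 0 <= u <= 1 -> 0 <= g u <= 1.
  by move=> /to_unitIK <-; have [] := g_close (to_unitI u).
have h_itv u : 0 <= u <= 1 -> 0 <= h u <= 1 - eta.
  move=> /g_itv /andP[g0 g1]; rewrite /h.
  by rewrite mulr_ge0 //= ?ler_piMr //; lra.
have eta_c : 1 - eta <= 1 by lra.
have [p p_itv hp] := lipschitz_fixed_point L0 eta_c hL h_itv.
(* the collapse then moves [h] by at most [L * delta], and the tents add at most
   [delta]: together [eta] *)
pose delta := eta / (L + 1).
have delta0 : 0 < delta by rewrite divr_gt0 //; lra.
have deltaE : L * delta + delta = eta by rewrite /delta; field; rewrite gt_eqF //; lra.
clearbody delta; have Ld0 : 0 <= L * delta by rewrite mulr_ge0 // ltW.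
have delta_eta : delta <= eta by lra.
have delta1 : delta <= 1 by lra.
have phi_cts := perturbed_map_continuous L0 hL h_itv p_itv delta0 delta_eta theta0.
pose phi : C0I R := (mkcts phi_cts : continuousType _ _).
exists phi.
  (* [eta] each for [phi] against [h], [h] against [g] and [g] against [f] *)
  have [x -> _] := C0I_dist_max f phi.
  rewrite unitI_distE /C0I_fun /= (perturbed_mapE h_itv p_itv) //.
  have [_ ] := g_close x; have /g_itv/andP[] := unitI_itv x.
  have := perturbed_close p L0 hL delta0 theta0 (set_val x).
  rewrite deltaE /h !ler_norml ltr_norml.
  move: (perturbed _ _ _ _ _) (g _) (set_val (C0I_fun f x)) => P G F'.
  move=> /andP[? ?] ? ? /andP[? ?]; apply/andP; split; nra.
have [ln4 ln2] : 0 <= ln (4 / delta) /\ 0 <= ln 2 :> R.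
  split; rewrite ln_ge0 ?ler1n //.
  by rewrite ler_pdivlMr // mul1r (le_trans delta1) // ler1n.
have lnL : 0 <= ln (2 * L + 11) by rewrite ln_ge0 //; lra.
exists (ln (2 * L + 11) + (ln (4 / delta) + ln 2)); split.
  move=> t E t0 E0 le_E.
  apply: le_trans (perturbed_sep_le L0 hL h_itv p_itv delta0 delta_eta delta1
    theta0 t0 E0 le_E) _.
  by rewrite lee_fin; lra.
move=> t k lt_t.
apply: le_trans (perturbed_sep_ge h_itv p_itv hp delta0 delta_eta delta1 theta0 _).
  by rewrite lee_fin; lra.
by lra.
Qed.

End approximation.

Theorem theorem3p6 (R : realType) (a b : R) (ha : a \in `[0, 1])
  (hb : b \in `[0, 1]) (hab : a < b) : dense (C0I_mdim a b).
Proof.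
have [a0 b1] : 0 <= a /\ b <= 1.
  by move: ha hb; rewrite !in_itv /= => /andP[-> _] /andP[_ ->].
move=> O [f Of] openO.
have /nbhs_ballP[r /= r0 fO] : nbhs f O by exact: open_nbhs_nbhs.
have [phi f_phi prof] :=
  dense_entropy_profile f (leg_exponent_ge0 a0 b1 hab) r0.
exists phi; split; first by apply: fO; rewrite /= ballEmdist.
by split; [exact: lower_rate prof | exact: upper_rate prof].
Qed.
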